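(* Let $\psi\in L^2(\mathbb R)$ and let $\mathcal W^M_\psi(j,k)=\langle f,\psi^M_{j,k}\rangle$, $j,k\in\mathbb Z$, be the discrete special affine wavelet transform of $f\in L^2(\mathbb R)$. Assume that the discrete system $\{\psi^M_{j,k}: j,k\in\mathbb Z\}$ satisfies the stability condition: there are constants $0<E\le F<\infty$ such that $$E\,\|f\|_2^2\le\sum_{j\in\mathbb Z}\sum_{k\in\mathbb Z}\big|\langle f,\psi^M_{j,k}\rangle\big|^2\le F\,\|f\|_2^2\qquad\text{for all } f\in L^2(\mathbb R),$$ and let $S$ be the linear operator on $L^2(\mathbb R)$ given by $$S(f)=\sum_{j\in\mathbb Z}\sum_{k\in\mathbb Z}\langle f,\psi^M_{j,k}\rangle\,\psi^M_{j,k}.$$ Then every $f\in L^2(\mathbb R)$ can be reconstructed as $$f=\sum_{j\in\mathbb Z}\sum_{k\in\mathbb Z}\langle f,\psi^M_{j,k}\rangle\,S^{-1}\big(\psi^M_{j,k}\big).$$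
   Context: $M=(A,B,C,D,p,q)$ is a tuple of real numbers with $AD-BC=1$ and $B\neq 0$ (''uni-modular matrix''). For $t,u\in\mathbb R$ put $$\mathcal K^M(t,u)=\frac{1}{i\sqrt{2\pi iB}}\exp\Big\{\frac{-i}{2B}\big(At^2+2t(p-u)-2u(Dp-Bq)+D(u^2+p^2)\big)\Big\}.$$ Fix positive constants $a_0,b_0$. For $\psi\in L^2(\mathbb R)$ and $j,k\in\mathbb Z$ put $$\psi^M_{j,k}(t)=a_0^{-j/2}\,\psi\big(a_0^{-j}t-kb_0\big)\,\mathcal K^M\big(t,kb_0a_0^{-j}\big).$$ The discrete special affine wavelet transform of $f\in L^2(\mathbb R)$ with respect to $\psi$ is $\mathcal W^M_\psi(j,k)=\int_{-\infty}^\infty f(t)\,\overline{\psi^M_{j,k}(t)}\,dt$. Inner products are those of $L^2(\mathbb R)$, linear in the first argument; series of functions converge in $L^2(\mathbb R)$, and $S^{-1}$ denotes the inverse of $S$. *)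

(* Defs.v *)
From HB Require Import structures.
From mathcomp Require Import all_boot all_order all_algebra.
From mathcomp Require Import generic_quotient ring_quotient finmap complex.
From mathcomp Require Import all_classical all_reals all_analysis measurable_realfun.
From mathcomp.analysis.showcase Require Import summability.
Set Implicit Arguments.
Unset Strict Implicit.
Unset Printing Implicit Defensive.
Import Order.TTheory GRing.Theory Num.Theory.
Import numFieldNormedType.Exports.
(* [complex] is imported again so that [Re] and [Im] denote the projections
   [R[i] -> R], not the [R[i]]-valued functions of [Num.Theory] *)
Import complex Normc.
Local Open Scope classical_set_scope.
Local Open Scope ring_scope.
Local Open Scope complex_scope.
Local Open Scope quotient_scope.

(** * The complex Hilbert space L^2(R) *)

Section SquareIntegrable.
Variable R : realType.
Local Notation mu := (@lebesgue_measure R).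
Implicit Types f g : R -> R[i].

Definition cmeasurable f :=
  measurable_fun setT (@Re R \o f) /\ measurable_fun setT (@Im R \o f).

(* [finite_norm mu 2 h] is finiteness of the norm of [h] in L^2([mu]) *)
Definition sqint : {pred R -> R[i]} :=
  [pred f | `[< cmeasurable f /\ finite_norm mu 2 (@normc R \o f) >]].

Lemma sqintP f :
  reflect (cmeasurable f /\ finite_norm mu 2 (@normc R \o f)) (f \in sqint).
Proof. by rewrite inE; exact: asboolP. Qed.

Lemma normcE (z : R[i]) : normc z = Num.sqrt (Re z ^+ 2 + Im z ^+ 2).
Proof. by case: z. Qed.

Lemma ReD (z w : R[i]) : Re (z + w) = Re z + Re w. Proof. by case: z; case: w. Qed.
Lemma ImD (z w : R[i]) : Im (z + w) = Im z + Im w. Proof. by case: z; case: w. Qed.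
Lemma ReM (z w : R[i]) : Re (z * w) = Re z * Re w - Im z * Im w.
Proof. by case: z; case: w. Qed.
Lemma ImM (z w : R[i]) : Im (z * w) = Re z * Im w + Im z * Re w.
Proof. by case: z; case: w. Qed.

Lemma normc_ge0 (z : R[i]) : 0 <= normc z.
Proof. by rewrite normcE sqrtr_ge0. Qed.

Lemma cmeasurable_normc f : cmeasurable f -> measurable_fun setT (@normc R \o f).
Proof.
move=> [mr mi].
rewrite (_ : _ \o _ = (@Num.sqrt R) \o
  (fun x => (@Re R \o f) x ^+ 2 + (@Im R \o f) x ^+ 2)).
  apply: measurableT_comp.
    by apply: continuous_measurable_fun; exact: sqrt_continuous.
  by apply: measurable_funD; exact: measurable_funX.
by apply/funext => x /=; rewrite normcE.
Qed.

Lemma cmeasurableD f g : cmeasurable f -> cmeasurable g ->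
  cmeasurable (f + g).
Proof.
move=> [fr fi] [gr gi]; split.
- rewrite (_ : _ \o _ = (@Re R \o f) \+ (@Re R \o g)).
    exact: measurable_funD.
  by apply/funext => x /=; rewrite -ReD.
- rewrite (_ : _ \o _ = (@Im R \o f) \+ (@Im R \o g)).
    exact: measurable_funD.
  by apply/funext => x /=; rewrite -ImD.
Qed.

Lemma cmeasurableM f g : cmeasurable f -> cmeasurable g ->
  cmeasurable (fun x => f x * g x).
Proof.
move=> [fr fi] [gr gi]; split.
- rewrite (_ : _ \o _ = (@Re R \o f) \* (@Re R \o g) \-
                        (@Im R \o f) \* (@Im R \o g)).
    by apply: measurable_funB; exact: measurable_funM.
  by apply/funext => x /=; rewrite -ReM.
- rewrite (_ : _ \o _ = (@Re R \o f) \* (@Im R \o g) \+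
                        (@Im R \o f) \* (@Re R \o g)).
    by apply: measurable_funD; exact: measurable_funM.
  by apply/funext => x /=; rewrite -ImM.
Qed.

Lemma cmeasurable_cst (c : R[i]) : cmeasurable (fun=> c).
Proof. by split; exact: measurable_cst. Qed.

Lemma measurable_norm2 (h : R -> R) : measurable_fun setT h ->
  measurable_fun setT (fun x => `|(EFin \o h) x| `^ 2)%E.
Proof.
move=> mh; rewrite (_ : (fun _ => _) = EFin \o (fun x => `|h x| `^ 2)).
  apply/measurable_EFinP.
  apply/(@measurableT_comp _ _ _ _ _ _ (fun x : R => x `^ 2)%R) => //.
  exact/measurableT_comp.
by apply/funext.
Qed.

Lemma Lnorm_normcD f g : cmeasurable f -> cmeasurable g ->
  ('N[mu]_2[EFin \o (@normc R \o (f + g)%R)] <=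
   'N[mu]_2[EFin \o (@normc R \o f)] + 'N[mu]_2[EFin \o (@normc R \o g)])%E.
Proof.
move=> mf mg.
have nf := cmeasurable_normc mf; have ng := cmeasurable_normc mg.
apply: (le_trans _ (eminkowski mu nf ng (lee1n 2))).
rewrite unlock; apply: gt0_ler_poweR => //.
- by rewrite in_itv/= leey integral_ge0.
- by rewrite in_itv/= leey integral_ge0.
apply: ge0_le_integral => //.
- by move=> x _; exact: poweR_ge0.
- by apply: measurable_norm2; apply: cmeasurable_normc; exact: cmeasurableD.
- by apply: measurable_norm2; exact: measurable_funD.
- move=> x _ /=; rewrite lee_fin.
  apply: (@ge0_ler_powR _ 2); rewrite ?nnegrE//.

  rewrite !ger0_norm ?addr_ge0 ?normc_ge0//.
  exact: le_normcD.
Qed.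

Lemma LnormM_normc (c : R[i]) f : cmeasurable f ->
  ('N[mu]_2[EFin \o (@normc R \o (c *: f)%R)] =
   (normc c)%:E * 'N[mu]_2[EFin \o (@normc R \o f)])%E.
Proof.
move=> mf; have nf := cmeasurable_normc mf.
rewrite unlock.
have -> : (fun x => `|(EFin \o (@normc R \o (c *: f)%R)) x| `^ 2)%E =
    (fun x => (normc c `^ 2)%:E * (`|(EFin \o (@normc R \o f)) x| `^ 2))%E.
  apply/funext => x; rewrite /= -EFinM; congr (_%:E).
  rewrite !ger0_norm ?normc_ge0// -powRM ?normc_ge0//.
  by rewrite [(c *: f) x]/(c * f x) normcM.
rewrite ge0_integralZl//.
- rewrite poweRM ?lee_fin ?powR_ge0//; last first.
    by apply: integral_ge0 => x _; exact: poweR_ge0.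
  congr (_ * _)%E.
  by rewrite poweR_EFin -powRrM mulfV// powRr1// normc_ge0.
- exact: measurable_norm2.
- by move=> x _; exact: poweR_ge0.
- by rewrite lee_fin powR_ge0.
Qed.

Lemma sqint_submod_closed : submod_closed sqint.
Proof.
split=> [|c f g /sqintP[mf nf] /sqintP[mg ng]]; apply/sqintP.
  split; first exact: cmeasurable_cst.
  rewrite /finite_norm (_ : _ \o _ = cst 0%E) ?Lnorm0//.
  by apply/funext => x; congr EFin; exact: normc0.
have mcf : cmeasurable (c *: f) by apply: (cmeasurableM (cmeasurable_cst c)).
split; first exact: cmeasurableD.
rewrite /finite_norm (le_lt_trans (Lnorm_normcD mcf mg))// LnormM_normc//.
by rewrite lte_add_pinfty// lte_mul_pinfty// lee_fin normc_ge0.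
Qed.

HB.instance Definition _ := GRing.isSubmodClosed.Build _ _ sqint
  sqint_submod_closed.

(* square-integrable functions, before identification of a.e. equal ones *)
Record L2fun := MkL2fun { L2fun_val :> R -> R[i]; _ : L2fun_val \in sqint }.

HB.instance Definition _ := [isSub for L2fun_val].
HB.instance Definition _ := [Choice of L2fun by <:].
HB.instance Definition _ := [SubChoice_isSubLmodule of L2fun by <:].

Lemma L2funP (f : L2fun) : (f : R -> R[i]) \in sqint.
Proof. exact: valP. Qed.

(* the submodule by which [L2fun] is quotiented to obtain [L2] *)
Definition ae0 : {pred L2fun} :=
  [pred f : L2fun | `[< {ae mu, forall x, f x = 0} >]].

Lemma ae0P (f : L2fun) : reflect {ae mu, forall x, f x = 0} (f \in ae0).
Proof. by rewrite inE; exact: asboolP. Qed.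

Lemma ae0_submod_closed : submod_closed ae0.
Proof.
split=> [|c f g /ae0P f0 /ae0P g0]; apply/ae0P; first exact/aeW.
move: f0 g0; apply: (@filterS2 _ _ (ae_filter_ringOfSetsType mu)).
move=> x /= f0 g0.
have : c * f x + g x = 0 by rewrite f0 g0 mulr0 addr0.
by [].
Qed.

HB.instance Definition _ := GRing.isSubmodClosed.Build _ _ ae0
  ae0_submod_closed.

Definition L2 : Type := Quotient.quot ae0.
HB.instance Definition _ := GRing.Zmodule.on L2.
HB.instance Definition _ := EqQuotient.on L2.

Lemma L2_eqP (f g : L2fun) :
  reflect {ae mu, forall x, f x = g x} (\pi_L2 f == \pi_L2 g).
Proof.
rewrite -Quotient.idealrBE; apply: (iffP (ae0P _));
  apply: (@filterS _ _ (ae_filter_ringOfSetsType mu)) => x /=.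
- by move=> fg0; apply/eqP; rewrite -subr_eq0; apply/eqP.
- by move=> fg; have : f x - g x = 0 by rewrite fg subrr.
Qed.

Definition L2_scale (c : R[i]) (f : L2) : L2 := \pi_L2 (c *: repr f).

Lemma pi_L2D (f g : L2fun) : \pi_L2 (f + g) = \pi_L2 f + \pi_L2 g.
Proof. by rewrite !piE. Qed.

Lemma pi_L2Z c (f : L2fun) : \pi_L2 (c *: f) = L2_scale c (\pi_L2 f).
Proof.
apply/eqP; rewrite -Quotient.idealrBE -scalerBr rpredZ//.
by rewrite Quotient.idealrBE reprK.
Qed.

Let L2_scalerA a b (f : L2) : L2_scale a (L2_scale b f) = L2_scale (a * b) f.
Proof.
elim/quotW: f => f.
by rewrite -[L2_scale b _]pi_L2Z -[LHS]pi_L2Z -[RHS]pi_L2Z scalerA.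
Qed.

Let L2_scale1r : left_id 1 L2_scale.
Proof. by elim/quotW => f; rewrite -[LHS]pi_L2Z scale1r. Qed.

Let L2_scalerDr : right_distributive L2_scale +%R.
Proof.
move=> a; elim/quotW => f; elim/quotW => g.
rewrite -[L2_scale a (\pi_L2 f)]pi_L2Z -[L2_scale a (\pi_L2 g)]pi_L2Z.
by rewrite -(pi_L2D f g) -[LHS]pi_L2Z scalerDr pi_L2D.
Qed.

Let L2_scalerDl (f : L2) : {morph L2_scale^~ f : a b / a + b}.
Proof. move=> a b; elim/quotW: f => f; rewrite -[LHS]pi_L2Z scalerDl pi_L2D.
by rewrite !pi_L2Z. Qed.

HB.instance Definition _ := GRing.Zmodule_isLmodule.Build R[i] L2
  L2_scalerA L2_scale1r L2_scalerDr L2_scalerDl.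

Lemma pi_L2_scale c (f : L2fun) : \pi_L2 (c *: f) = c *: \pi_L2 f.
Proof. exact: pi_L2Z. Qed.

Definition L2norm (f : L2) : R :=
  fine ('N[mu]_2[EFin \o (@normc R \o (repr f : L2fun))])%E.

Lemma L2norm_pi (f : L2fun) :
  ((L2norm (\pi_L2 f))%:E = 'N[mu]_2[EFin \o (@normc R \o f)])%E.
Proof.
have /sqintP[mf nf] := L2funP f.
have /sqintP[mrf nrf] := L2funP (repr (\pi_L2 f)).
have e := cmeasurable_normc mf; have re := cmeasurable_normc mrf.
rewrite /L2norm fineK; last first.
  by rewrite ge0_fin_numE ?Lnorm_ge0.
rewrite unlock; congr (_ `^ _)%E; apply: ae_eq_integral => //.
- exact: measurable_norm2.
- exact: measurable_norm2.
have /L2_eqP : \pi_L2 (repr (\pi_L2 f)) == \pi_L2 f by rewrite reprK.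
by apply: (@filterS _ _ (ae_filter_ringOfSetsType mu)) => x /= ->.
Qed.

Definition L2cnorm (f : L2) : R[i] := (L2norm f)%:C.

Let L2cnormD (f g : L2) : L2cnorm (f + g) <= L2cnorm f + L2cnorm g.
Proof.
elim/quotW: f => f; elim/quotW: g => g.
have /sqintP[mf nf] := L2funP f; have /sqintP[mg ng] := L2funP g.
rewrite /L2cnorm -rmorphD lecR -lee_fin EFinD.
by rewrite -pi_L2D !L2norm_pi Lnorm_normcD.
Qed.

Let L2cnormZ (c : R[i]) (f : L2) : L2cnorm (c *: f) = `|c| * L2cnorm f.
Proof.
elim/quotW: f => f; have /sqintP[mf nf] := L2funP f.
rewrite /L2cnorm normc_def -normcE -rmorphM; congr (_%:C).
apply: EFin_inj; rewrite EFinM.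
by rewrite -pi_L2_scale !L2norm_pi LnormM_normc.
Qed.

Let L2cnorm0_eq0 (f : L2) : L2cnorm f = 0 -> f = 0.
Proof.
elim/quotW: f => f [f0]; have /sqintP[mf nf] := L2funP f.
have mnf := cmeasurable_normc mf.
have {}f0 : (L2norm (\pi_L2 f))%:E = 0%E by rewrite f0.
rewrite L2norm_pi in f0.
have mE := proj2 (@measurable_EFinP _ _ _ setT (@normc R \o f)) mnf.
have two : (0 < 2%:E :> \bar R)%E by rewrite lte_fin.
have ae0f := @Lnorm_eq0_eq0 _ (measurableTypeR R) R mu _ _ mE two f0.
apply/eqP; rewrite (_ : 0 = \pi_L2 0); last by rewrite piE.
apply/L2_eqP; move: ae0f.
apply: (@filterS _ _ (ae_filter_ringOfSetsType mu)) => x /= /(_ I)[].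
exact: eq0_normc.
Qed.

HB.instance Definition _ := Lmodule_isNormed.Build R[i] L2
  L2cnormD L2cnormZ L2cnorm0_eq0.

(* [L2 R] is a [normedModType] over [R[i]]; its norm [`|f|] is [R[i]]-valued *)
Lemma L2normE (f : L2) : `|f| = (L2norm f)%:C.
Proof. by []. Qed.

Definition cintegral (h : R -> R[i]) : R[i] :=
  (\int[mu]_x Re (h x)) +i* (\int[mu]_x Im (h x)).

(* linear in the first argument *)
Definition L2dot (f g : L2) : R[i] :=
  cintegral (fun x => (repr f : L2fun) x * ((repr g : L2fun) x)^*).

End SquareIntegrable.

Section AffineChange.
Variable R : realType.
Local Notation mu := (@lebesgue_measure R).

Definition affine (a b : R) (x : measurableTypeR R) : measurableTypeR R :=
  a * x - b.

Lemma measurable_affine a b : measurable_fun setT (affine a b).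
Proof.
apply: measurable_funB; last exact: measurable_cst.
by apply: measurable_funM; [exact: measurable_cst|exact: measurable_id].
Qed.

HB.instance Definition _ a b := isMeasurableFun.Build _ _ _ _ (affine a b)
  (measurable_affine a b).

Lemma ge0_integral_affine (a b : R) (f : R -> \bar R) : 0 < a ->
  measurable_fun setT f -> (forall x, 0 <= f x)%E ->
  (\int[mu]_x f x = a%:E * \int[mu]_x f (a * x - b)%R)%E.
Proof.
move=> a0 mf f0.
pose nu0 : {measure set (measurableTypeR R) -> \bar R} :=
  mscale (NngNum (ltW a0)) (pushforward mu (affine a b)).
pose nu := nu0 (measurable_affine a b).
transitivity (\int[nu]_x f x)%E.
  apply: eq_measure_integral => A mA _.
  apply: (lebesgue_measure_unique (mu := nu)) => // _ [[x y]] _ <-.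
  have pre : affine a b @^-1` `]x, y]%classic =
      `](x + b) / a, (y + b) / a]%classic.
    by apply/seteqP; split => z /=; rewrite !in_itv/= /affine;
      rewrite ltr_pdivrMr// ler_pdivlMr// mulrC ltrBrDr lerBlDr.
  transitivity (a%:E * mu `](x + b) / a, (y + b) / a]%classic%R)%E; last first.
    by rewrite -pre.
  rewrite !lebesgue_measure_itv/= !lte_fin ltr_pM2r ?invr_gt0// ltrD2r.
  case: ifPn => xy; last by rewrite mule0.
  rewrite -!EFinD -EFinM; congr (_%:E).
  by rewrite -mulrBl opprD addrACA subrr addr0 mulrC divfK// gt_eqF.
rewrite ge0_integral_mscale//; congr (_ * _)%E.
by rewrite ge0_integral_pushforward.
Qed.

End AffineChange.

Section SpecialAffineWavelet.
Variable R : realType.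
Local Notation mu := (@lebesgue_measure R).

Record unimodular := Unimodular {
  uA : R; uB : R; uC : R; uD : R; up : R; uq : R;
  unimodular_det : uA * uD - uB * uC = 1;
  uB_neq0 : uB != 0
}.

Definition cexp (z : R[i]) : R[i] :=
  (expR (Re z))%:C * (cos (Im z) +i* sin (Im z)).

(* [sqrtc] is the principal square root (nonnegative real part) *)
Definition sa_kernel (M : unimodular) (t u : R) : R[i] :=
  let: Unimodular A B C D p q _ _ := M in
  ('i * sqrtc ((2 * pi)%:C * 'i * B%:C))^-1 *
  cexp (- 'i / (2 * B)%:C *
    (A * t ^+ 2 + 2 * t * (p - u) - 2 * u * (D * p - B * q)
     + D * (u ^+ 2 + p ^+ 2))%:C).

Definition sa_wavelet_fun (M : unimodular) (a0 b0 : R) (psi : R -> R[i])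
    (j k : int) (t : R) : R[i] :=
  (a0 `^ (- j%:~R / 2))%:C * psi (a0 ^ (- j) * t - k%:~R * b0) *
  sa_kernel M t (k%:~R * b0 * a0 ^ (- j)).

Lemma cexp_imag (B x : R) :
  cexp (- 'i / B%:C * x%:C) = cos (- (x / B)) +i* sin (- (x / B)).
Proof.
have -> : - 'i / B%:C * x%:C = 0 +i* (- (x / B)).
  rewrite -fmorphV -mulrA -rmorphM/=; simpc.
  by rewrite mulrC.
by rewrite /cexp /= expR0 mul1r.
Qed.

Lemma normc_cis (x : R) : normc (cos x +i* sin x) = 1.
Proof. by rewrite /= cos2Dsin2 sqrtr1. Qed.

Lemma cmeasurable_cis (h : R -> R) : measurable_fun setT h ->
  cmeasurable (fun x => cos (h x) +i* sin (h x)).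
Proof.
move=> mh; split.
- by apply: (measurableT_comp _ mh); apply: continuous_measurable_fun;
    exact: continuous_cos.
- by apply: (measurableT_comp _ mh); apply: continuous_measurable_fun;
    exact: continuous_sin.
Qed.

Lemma cmeasurable_affine (f : R -> R[i]) a b :
  cmeasurable f -> cmeasurable (fun x => f (a * x - b)).
Proof.
by move=> [fr fi]; split;
  [exact: (measurableT_comp fr (measurable_affine a b))
  |exact: (measurableT_comp fi (measurable_affine a b))].
Qed.

Lemma sa_wavelet_fun_sqint M (a0 b0 : R) (psi : R -> R[i]) j k :
  0 < a0 -> psi \in @sqint R -> sa_wavelet_fun M a0 b0 psi j k \in @sqint R.
Proof.
move=> a0_gt0 /sqintP[mpsi npsi].
case: M => A B C D p q det B0.
pose a := a0 ^ (- j); pose u := k%:~R * b0 * a.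
pose h (t : R) := - ((A * t ^+ 2 + 2 * t * (p - u) - 2 * u * (D * p - B * q)
     + D * (u ^+ 2 + p ^+ 2)) / (2 * B)).
pose c : R[i] := (a0 `^ (- j%:~R / 2))%:C *
  ('i * sqrtc ((2 * pi)%:C * 'i * B%:C))^-1.
pose g (t : R) : R[i] := psi (a * t - k%:~R * b0) * (cos (h t) +i* sin (h t)).
have mh : measurable_fun setT h.
  apply: continuous_measurable_fun => x.
  by apply: cvgN; apply: cvgMl; apply: cvgD; [apply: cvgB; [apply: cvgD|]|];
    do ?[exact: cvg_cst | exact: cvg_id | apply: cvgM | apply: exprn_continuous].
have mg : cmeasurable g.
  by apply: cmeasurableM; [exact: cmeasurable_affine|exact: cmeasurable_cis].
have -> : sa_wavelet_fun (@Unimodular A B C D p q det B0) a0 b0 psi j k = c *: g.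
  apply/funext => t; rewrite /sa_wavelet_fun /sa_kernel cexp_imag.
  by rewrite [RHS]/(c * g t) /c /g mulrACA.
suff gS : g \in @sqint R by rewrite rpredZ.
apply/sqintP; split => //.
have a_gt0 : 0 < a by rewrite exprz_gt0.
move: npsi; rewrite /finite_norm unlock => npsi.
pose H (t : R) := (`|(EFin \o (@normc R \o psi)) t| `^ 2)%E.
have Hfin : (\int[mu]_t H t < +oo)%E.
  by apply: (@lty_poweRy _ _ 2^-1); rewrite ?invr_neq0.
apply: poweR_lty.
have -> : (fun t => `|(EFin \o (@normc R \o g)) t| `^ 2)%E =
          (fun t => H (a * t - k%:~R * b0)).
  by apply/funext => t; rewrite /H /= normcM normc_cis mulr1.
move: Hfin; rewrite (ge0_integral_affine (k%:~R * b0) a_gt0) => [||t].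
- by rewrite !ltey; apply: contraNneq => ->; rewrite gt0_muley.
- by apply: measurable_norm2; exact: cmeasurable_normc.
- exact: poweR_ge0.
Qed.

(* [psi] is a square-integrable function, [sa_wavelet M a0 b0 psi j k] the class
   in [L2 R] of psi^M_{j,k} *)
Definition sa_wavelet_L2fun M (a0 b0 : {posnum R}) (psi : L2fun R) j k :
    L2fun R :=
  MkL2fun (sa_wavelet_fun_sqint M b0%:num j k (gt0 a0) (L2funP psi)).

Definition sa_wavelet M (a0 b0 : {posnum R}) (psi : L2fun R) j k : L2 R :=
  \pi_(L2 R) (sa_wavelet_L2fun M a0 b0 psi j k).

Definition dsawt M (a0 b0 : {posnum R}) (psi : L2fun R) (f : L2 R) j k : R[i] :=
  L2dot f (sa_wavelet M a0 b0 psi j k).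

End SpecialAffineWavelet.

Section FrameOperator.
Variable R : realType.
Implicit Types (e u : int -> int -> L2 R) (f : L2 R).

(* The double series [\sum_j \sum_k u j k] is understood as the L^2-norm limit
   of its partial sums along the directed set of finite subsets of Z x Z
   (unconditional convergence); when it exists, the iterated sums converge to
   the same limit. *)
Definition L2_partial_sum u : {fset int * int} -> L2 R :=
  partial_sum (fun jk => u jk.1 jk.2).

Definition L2_has_sum u f : Prop := L2_partial_sum u @ totally --> f.

Definition frame_op e f : L2 R :=
  lim (L2_partial_sum (fun j k => L2dot f (e j k) *: e j k) @ totally).

End FrameOperator.

(* Main.v *)
From HB Require Import structures.
Require Import Defs.
From mathcomp Require Import all_boot all_order all_algebra.
From mathcomp Require Import generic_quotient finmap complex ring lra.
From mathcomp Require Import all_classical all_reals all_analysis.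
From mathcomp Require Import measurable_realfun.
From mathcomp.analysis.showcase Require Import summability.
Import Order.TTheory GRing.Theory Num.Theory.
Import numFieldNormedType.Exports.
Import complex Normc.
Local Open Scope classical_set_scope.
Local Open Scope ring_scope.

(** The stability condition says that the system [e] of the wavelets is a frame
    of the complex Hilbert space L^2(R), with bounds [E] and [F], and the theorem is
    the reconstruction formula for frames.

    The upper bound, dualised ([sqr_nrm_partial_sum_le]), says that a finite
    combination of the [e i] has squared norm at most [F] times the sum of the
    squared moduli of its coefficients.  The partial sums defining [S f] are
    therefore Cauchy, because the sum of the squares |<f, e i>|^2 converges, and
    [S] is a bounded linear operator.  The lower bound makes it coercive,
    [E |f|^2 <= Re <S f, f>], hence bounded below, [E |f| <= |S f|], hence
    injective.

    For surjectivity, [S] being coercive and bounded, the map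
    [r |-> r - t S r] is a strict contraction for [t = E / F^2].  The relaxation
    [x_{n+1} = x_n + t (g - S x_n)] has residuals [g - S x_n] that are iterates
    of this map, so [S x_n] tends to [g]; as [S] is bounded below, [x_n] is
    Cauchy, and its limit is a preimage of [g].  Finally the inverse of [S] is
    linear and bounded by [1 / E], so that it may be applied term by term to the
    series of [S f]; this yields the reconstruction of [f].

    What has to be known of L^2(R) is that its pairing is an inner product
    inducing its norm, and that it is complete.  The latter is the Riesz-Fischer
    theorem: a Cauchy filter yields a sequence whose increments have norms at
    most [4^-n]; the sum of the [4^n |u_{n+1} - u_n|^2] is integrable, so
    almost everywhere the increments are dominated by a geometric sequence
    and the sequence converges pointwise; Fatou's lemma turns this into
    convergence in norm. *)

(** * Complex numbers and finite partial sums *)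

Section ComplexNumbers.
Set Implicit Arguments.
Unset Strict Implicit.
Local Open Scope complex_scope.
Variable R : realType.
Implicit Types z w : R[i].

Lemma sqr_normc z : normc z ^+ 2 = Re z ^+ 2 + Im z ^+ 2.
Proof. by rewrite Defs.normcE sqr_sqrtr// addr_ge0 ?sqr_ge0. Qed.

Lemma Re_sum J (r : seq J) (x : J -> R[i]) :
  Re (\sum_(i <- r) x i) = \sum_(i <- r) Re (x i).
Proof. by apply: (big_morph (@Re R)) => // z w; rewrite ReD. Qed.

Lemma gt0_complexE z : 0 < z -> exists2 r : R, 0 < r & z = r%:C.
Proof.
by case: z => a b; rewrite ltcE /= => /andP[/eqP-> a0]; exists a.
Qed.

(** Young's inequality; the free weight [c] lets an unknown on the right be
    absorbed on the left, which spares a Cauchy-Schwarz inequality for sums. *)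
Lemma ler_Re_mulJ (c : R) z w : 0 < c ->
  Re (z * w^*) <= (c * normc z ^+ 2 + c^-1 * normc w ^+ 2) / 2.
Proof.
move=> c0; rewrite !sqr_normc; case: z w => a b [x y] /=; rewrite -subr_ge0.
have -> : (c * (a ^+ 2 + b ^+ 2) + c^-1 * (x ^+ 2 + y ^+ 2)) / 2 -
    (a * x - b * - y) = c^-1 * ((c * a - x) ^+ 2 + (c * b - y) ^+ 2) / 2.
  by field; rewrite gt_eqF.
by rewrite !mulr_ge0 ?invr_ge0 ?addr_ge0 ?sqr_ge0// ltW.
Qed.

Lemma ler_norm_ReIm_mulJ z w :
  `|Re (z * w^*)| <= normc z ^+ 2 + normc w ^+ 2 /\
  `|Im (z * w^*)| <= normc z ^+ 2 + normc w ^+ 2.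
Proof.
rewrite !sqr_normc; case: z w => a b [c d] /=.
have := (sqr_ge0 (a + c), sqr_ge0 (a - c), sqr_ge0 (a + d), sqr_ge0 (a - d)).
have := (sqr_ge0 (b + c), sqr_ge0 (b - c), sqr_ge0 (b + d), sqr_ge0 (b - d)).
have := (sqr_ge0 a, sqr_ge0 b, sqr_ge0 c, sqr_ge0 d).
move=> -[[[? ?] ?] ?] [[[? ?] ?] ?] [[[? ?] ?] ?].
by split; rewrite ler_norml; apply/andP; split; lra.
Qed.

End ComplexNumbers.

Section PartialSums.
Set Implicit Arguments.
Unset Strict Implicit.

Lemma partial_sumE (I : choiceType) (W : zmodType) (x : I -> W) (A : {fset I}) :
  partial_sum x A = \sum_(i <- A) x i.
Proof. by rewrite /partial_sum big_seq_fsetE. Qed.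

Lemma partial_sum_fsetD (I : choiceType) (W : zmodType) (x : I -> W)
    (A B : {fset I}) : (A `<=` B)%fset ->
  partial_sum x B = partial_sum x A + partial_sum x (B `\` A)%fset.
Proof.
move=> AB; rewrite !partial_sumE (big_fsetID _ (mem A))/=; congr (_ + _).
  apply: eq_fbigl => i; rewrite !inE/= andbC.
  by case: (boolP (i \in A)) => //= /(fsubsetP AB).
by apply: eq_fbigl => i; rewrite !inE/= andbC.
Qed.

(** Both frame bounds are statements about this iterated sum; in this form they
    become statements about finite partial sums, the lower one by taking for
    [c] any upper bound of those. *)
Lemma esum2_leP (R : realType) (I J : choiceType) (a : I -> J -> R) (c : R) :
  (forall i j, 0 <= a i j) ->
  (\esum_(i in [set: I]) \esum_(j in [set: J]) (a i j)%:E <= c%:E)%E <->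
  forall A : {fset I * J}, partial_sum (fun ij => a ij.1 ij.2) A <= c.
Proof.
move=> a0; rewrite esum_esum; last by move=> i j _ _; rewrite lee_fin.
have sumE (A : {fset I * J}) : (partial_sum (fun ij => a ij.1 ij.2) A)%:E =
    (\sum_(ij \in [set` A]) (a ij.1 ij.2)%:E)%E.
  by rewrite fsbig_finite//= set_fsetK partial_sumE sumEFin.
split=> [ac A|ac].
  rewrite -lee_fin; apply: le_trans ac; rewrite sumE.
  by apply: esum_ge; exists [set` A] => //; split.
apply: ge_ereal_sup => _ [_ [/finite_fsetP[A ->] _] <-].
by rewrite -sumE lee_fin.
Qed.

End PartialSums.

(** * Frames in a complex Hilbert space *)

Section Hilbert.
Set Implicit Arguments.
Unset Strict Implicit.
Local Open Scope complex_scope.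
Variables (R : realType) (V : completeNormedModType R[i]).
(* The norm of [V] takes its values in [R[i]]; all estimates are made with its
   real counterpart [nrm], where the order is total. *)
Variables (nrm : V -> R) (dot : V -> V -> R[i]).
Hypothesis nrmE : forall f, `|f| = (nrm f)%:C.
Hypothesis dot_linear : forall h, linear (dot^~ h : V -> R[i]^o).
Hypothesis dotC : forall f g, dot g f = (dot f g)^*.
Hypothesis dotff : forall f, dot f f = (nrm f ^+ 2)%:C.

Lemma nrm_ge0 f : 0 <= nrm f.
Proof. by rewrite -lecR -nrmE normr_ge0. Qed.

Lemma nrm0 : nrm 0 = 0.
Proof. by apply: complexI; rewrite -nrmE normr0. Qed.

Lemma ler_nrmD f g : nrm (f + g) <= nrm f + nrm g.
Proof. by rewrite -lecR rmorphD/= -!nrmE ler_normD. Qed.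

Lemma nrmN f : nrm (- f) = nrm f.
Proof. by apply: complexI; rewrite -!nrmE normrN. Qed.

Lemma nrmZ (a : R) f : nrm (a%:C *: f) = `|a| * nrm f.
Proof.
apply: complexI; rewrite -nrmE normrZ nrmE normc_def /=.
by rewrite expr0n addr0 sqrtr_sqr -rmorphM.
Qed.

Lemma cvg_nrmP {T : Type} {F : set_system T} {FF : Filter F} (u : T -> V) l :
  u @ F --> l <->
  forall eps : R, 0 < eps -> \forall x \near F, nrm (l - u x) < eps.
Proof.
split=> [/cvgrPdist_lt ul eps e0|ul].
  have := ul eps%:C; rewrite ltcR => /(_ e0).
  by apply: filterS => x; rewrite nrmE ltcR.
apply/cvgrPdist_lt => _ /gt0_complexE[eps e0 ->].
by near=> x; rewrite nrmE ltcR; near: x; exact: ul.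
Unshelve. all: by end_near. Qed.

Lemma dotDl f g h : dot (f + g) h = dot f h + dot g h.
Proof. by have := dot_linear h 1 f g; rewrite !scale1r. Qed.

Lemma dot0l h : dot 0 h = 0.
Proof. by apply: (addrI (dot 0 h)); rewrite -dotDl !addr0. Qed.

Lemma dotZl c f h : dot (c *: f) h = c * dot f h.
Proof. by have := dot_linear h c f 0; rewrite !addr0 dot0l addr0. Qed.

Lemma dotNl f h : dot (- f) h = - dot f h.
Proof. by rewrite -scaleN1r dotZl mulN1r. Qed.

Lemma dot_suml J (r : seq J) (x : J -> V) g :
  dot (\sum_(i <- r) x i) g = \sum_(i <- r) dot (x i) g.
Proof. by apply: (big_morph (dot^~ g)) => [f h|]; rewrite ?dotDl ?dot0l. Qed.

Lemma Re_dotC f g : Re (dot g f) = Re (dot f g).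
Proof. by rewrite dotC; case: (dot f g). Qed.

Lemma Re_dotZl (a : R) f g : Re (dot (a%:C *: f) g) = a * Re (dot f g).
Proof. by rewrite dotZl; case: (dot f g) => x y /=; rewrite mul0r subr0. Qed.

Lemma sqr_nrmD f g :
  nrm (f + g) ^+ 2 = nrm f ^+ 2 + 2 * Re (dot f g) + nrm g ^+ 2.
Proof.
have nE h : nrm h ^+ 2 = Re (dot h h) by rewrite dotff.
rewrite !nE dotDl ReD (Re_dotC (f + g) f) (Re_dotC (f + g) g) !dotDl !ReD.
rewrite (Re_dotC f g); ring.
Qed.

(** Cauchy-Schwarz, from the positivity of the square of the norm of
    [|g| f - |f| g]. *)
Lemma Re_dot_le f g : Re (dot f g) <= nrm f * nrm g.
Proof.
have [->|f0] := eqVneq f 0; first by rewrite dot0l nrm0 mul0r.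
have [->|g0] := eqVneq g 0; first by rewrite Re_dotC dot0l nrm0 mulr0.
have gt0 h : h != 0 -> 0 < nrm h.
  by move=> h0; rewrite -ltcR -nrmE normr_gt0.
have := sqr_ge0 (nrm ((nrm g)%:C *: f + (- nrm f)%:C *: g)).
rewrite sqr_nrmD !nrmZ Re_dotZl Re_dotC Re_dotZl Re_dotC normrN.
rewrite !ger0_norm ?nrm_ge0//.
set a := nrm f; set b := nrm g; set r := Re _.
have a0 : 0 < a by exact: gt0.
have b0 : 0 < b by exact: gt0.
have -> : (b * a) ^+ 2 + 2 * (b * (- a * r)) + (a * b) ^+ 2 =
  2 * (a * b) * (a * b - r) by ring.
by rewrite pmulr_rge0 ?subr_ge0// mulr_gt0// mulr_gt0.
Qed.

Section Frame.
Variables (I : choiceType) (e : I -> V) (E F : R).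
Implicit Types A B : {fset I}.

Definition energy f := partial_sum (fun i => normc (dot f (e i)) ^+ 2).
Definition frame_sum f := partial_sum (fun i => dot f (e i) *: e i).
Definition frame_operator f := lim (frame_sum f @ totally).

Hypothesis F_gt0 : 0 < F.
Hypothesis energy_le : forall f A, energy f A <= F * nrm f ^+ 2.

(** If [g] is the combination, [|g|^2] is the real part of the sum of the
    [c i * <e i, g>].  Young's inequality with weight [F] bounds it by half of
    the right-hand side plus half of [energy g A / F], and the latter is at most
    half of [|g|^2]. *)
Lemma sqr_nrm_partial_sum_le (c : I -> R[i]) A :
  nrm (partial_sum (fun i => c i *: e i) A) ^+ 2 <=
  F * partial_sum (fun i => normc (c i) ^+ 2) A.
Proof.
set g := partial_sum _ A.
have gE : nrm g ^+ 2 = \sum_(i <- A) Re (c i * (dot g (e i))^*).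
  have -> : nrm g ^+ 2 = Re (dot g g) by rewrite dotff.
  rewrite {1}/g partial_sumE dot_suml Re_sum.
  by apply: eq_bigr => i _; rewrite dotZl (dotC g).
have : nrm g ^+ 2 <= (F * partial_sum (fun i => normc (c i) ^+ 2) A +
                      F^-1 * energy g A) / 2.
  rewrite gE /energy !partial_sumE !mulr_sumr -big_split/= mulr_suml.
  by apply: ler_sum => i _; exact: ler_Re_mulJ.
have : F^-1 * energy g A <= nrm g ^+ 2 by rewrite ler_pdivrMl// energy_le.
lra.
Qed.

Lemma energyS f A B : (A `<=` B)%fset -> energy f A <= energy f B.
Proof.
move=> AB; rewrite [leRHS](partial_sum_fsetD _ AB) lerDl partial_sumE.
by apply: sumr_ge0 => i _; exact: sqr_ge0.
Qed.

Lemma frame_sum_tail f A B : (A `<=` B)%fset ->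
  nrm (frame_sum f B - frame_sum f A) ^+ 2 <= F * (energy f B - energy f A).
Proof.
move=> AB; rewrite /energy /frame_sum !(partial_sum_fsetD _ AB).
rewrite !(addrAC _ _ (- _)) !subrr !add0r.
exact: sqr_nrm_partial_sum_le.
Qed.

(** The energies are bounded, so beyond some finite set they differ from their
    supremum by less than any given tolerance, and so do the partial sums among
    themselves. *)
Lemma is_cvg_frame_sum f : cvg (frame_sum f @ totally).
Proof.
have FT := @totally_filter I.
apply: cauchy_cvg; apply: cauchy_exP => _ /gt0_complexE[eps e0 ->].
have supE : has_sup (range (energy f)).
  split; first by exists (energy f fset0), fset0.
  by exists (F * nrm f ^+ 2) => _ [A _ <-].
have d0 : 0 < eps ^+ 2 / F by rewrite divr_gt0// exprn_gt0.
have [_ [A _ <-] supA] := sup_adherent d0 supE.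
exists (frame_sum f A); exists A => // B /= AB.
rewrite -ball_normE /ball_/= distrC nrmE ltcR.
rewrite -(ltr_pXn2r (n := 2)) ?nnegrE ?nrm_ge0 ?(ltW e0)//.
apply: (le_lt_trans (frame_sum_tail f AB)).
rewrite mulrC -ltr_pdivlMr//.
have : energy f B <= sup (range (energy f)).
  by apply: sup_upper_bound => //; exists B.
lra.
Qed.

Lemma frame_sum_cvg f : frame_sum f @ totally --> frame_operator f.
Proof. exact: is_cvg_frame_sum. Qed.

Lemma frame_sum_near f (eps : R) A : 0 < eps ->
  exists2 B, (A `<=` B)%fset & nrm (frame_operator f - frame_sum f B) < eps.
Proof.
move=> e0; have FT := @totally_filter I.
have [B _ BP] := (cvg_nrmP _ _).1 (@frame_sum_cvg f) _ e0.
by exists (A `|` B)%fset; [exact: fsubsetUl|apply: BP; exact: fsubsetUr].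
Qed.

Lemma frame_operator_linear : linear frame_operator.
Proof.
move=> c f g; have FT := @totally_filter I.
apply: (cvg_unique (@norm_hausdorff _ V) (@frame_sum_cvg (c *: f + g))).
have -> : frame_sum (c *: f + g) =
    (fun A => c *: frame_sum f A + frame_sum g A).
  apply/funext => A; rewrite /frame_sum !partial_sumE scaler_sumr -big_split.
  by apply: eq_bigr => i _; rewrite /= dotDl dotZl scalerDl scalerA.
by apply: cvgD; [apply: cvgZl_tmp|]; exact: frame_sum_cvg.
Qed.

Lemma frame_operatorB f g :
  frame_operator (f - g) = frame_operator f - frame_operator g.
Proof.
by have := frame_operator_linear (-1) g f; rewrite !scaleN1r !(addrC (- _)).
Qed.

Lemma frame_operator0 : frame_operator 0 = 0.
Proof. by have := frame_operatorB 0 0; rewrite !subrr. Qed.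

Lemma frame_operator_bounded f : nrm (frame_operator f) <= F * nrm f.
Proof.
apply/ler_addgt0Pr => eps e0.
have [B _ fB] := frame_sum_near f fset0 e0.
rewrite -[frame_operator f](subrK (frame_sum f B)) addrC.
apply: le_trans (ler_nrmD _ _) _; apply: lerD; last exact: ltW.
rewrite -(ler_pXn2r (n := 2)) ?nnegrE ?nrm_ge0 ?mulr_ge0 ?nrm_ge0 ?(ltW F_gt0)//.
apply: le_trans (sqr_nrm_partial_sum_le _ B) _.
by rewrite exprMn expr2 -mulrA ler_pM2l//; exact: energy_le.
Qed.

Lemma Re_dot_frame_sum f A : Re (dot (frame_sum f A) f) = energy f A.
Proof.
rewrite /frame_sum /energy !partial_sumE dot_suml Re_sum.
apply: eq_bigr => i _; rewrite dotZl (dotC f) sqr_normc.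
by case: (dot f (e i)) => a b /=; ring.
Qed.

Lemma energy_le_dot f A : energy f A <= Re (dot (frame_operator f) f).
Proof.
apply/ler_addgt0Pr => eps e0; have f0 := nrm_ge0 f.
(* the added 1 keeps the tolerance meaningful when [f] vanishes *)
have [B AB fB] := @frame_sum_near f (eps / (nrm f + 1)) A
  (divr_gt0 e0 (ltr_wpDl f0 ltr01)).
apply: (le_trans (energyS f AB)); rewrite -Re_dot_frame_sum.
have -> : frame_sum f B = frame_operator f - (frame_operator f - frame_sum f B).
  by rewrite opprB addrC subrK.
rewrite dotDl ReD lerD2l.
apply: le_trans (Re_dot_le _ _) _; rewrite nrmN.
apply: (@le_trans _ _ (eps / (nrm f + 1) * nrm f)).
  by rewrite ler_wpM2r// ltW.
rewrite mulrAC ler_pdivrMr ?ltr_wpDl// ler_pM2l//; lra.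
Qed.

Hypothesis E_gt0 : 0 < E.
Hypothesis le_EF : E <= F.
(* the lower frame bound, the total energy being the least upper bound of the
   energies of finite sets *)
Hypothesis energy_ge : forall f c, (forall A, energy f A <= c) ->
  E * nrm f ^+ 2 <= c.

Lemma frame_operator_coercive f :
  E * nrm f ^+ 2 <= Re (dot (frame_operator f) f).
Proof. by apply: energy_ge => A; exact: energy_le_dot. Qed.

Lemma frame_operator_lower f : E * nrm f <= nrm (frame_operator f).
Proof.
have [->|f0] := eqVneq (nrm f) 0; first by rewrite mulr0 nrm_ge0.
have f_gt0 : 0 < nrm f by rewrite lt0r f0 nrm_ge0.
have := le_trans (frame_operator_coercive f) (Re_dot_le _ _).
by rewrite expr2 mulrA ler_pM2r.
Qed.

Lemma frame_operator_inj : injective frame_operator.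
Proof.
move=> f g fg; apply/eqP; rewrite -subr_eq0 -normr_eq0 nrmE.
have := frame_operator_lower (f - g); rewrite frame_operatorB fg subrr nrm0.
rewrite pmulr_rle0// => h; apply/eqP; congr (_%:C); apply/eqP.
by rewrite eq_le h nrm_ge0.
Qed.

(* [t] minimises the bound [1 - 2 t E + t^2 F^2] on the square of the norm of
   [r - t S r] relative to that of [r]; [q^2] is the minimum *)
Let t := E / F ^+ 2.
Let q := Num.sqrt (1 - (E / F) ^+ 2).

Lemma relaxation_contraction r :
  nrm (r - t%:C *: frame_operator r) <= q * nrm r.
Proof.
have EF : 0 <= 1 - (E / F) ^+ 2.
  by rewrite subr_ge0 expr_le1// ?ler_pdivrMr ?mul1r// divr_ge0 ?ltW.
rewrite -(ler_pXn2r (n := 2)) ?nnegrE ?nrm_ge0 ?mulr_ge0 ?nrm_ge0 ?sqrtr_ge0//.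
rewrite exprMn sqr_sqrtr// sqr_nrmD nrmN nrmZ Re_dotC dotNl raddfN/= Re_dotZl.
have t0 : 0 < t by rewrite divr_gt0// exprn_gt0.
have : t * (E * nrm r ^+ 2) <= t * Re (dot (frame_operator r) r).
  by rewrite ler_pM2l// frame_operator_coercive.
have : t ^+ 2 * nrm (frame_operator r) ^+ 2 <= t ^+ 2 * (F ^+ 2 * nrm r ^+ 2).
  rewrite ler_pM2l ?exprn_gt0// -exprMn.
  by rewrite lerXn2r ?nnegrE ?mulr_ge0 ?nrm_ge0 ?frame_operator_bounded// ltW.
rewrite [(`|t| * _) ^+ 2]exprMn real_normK ?num_real//.
have -> : t ^+ 2 * (F ^+ 2 * nrm r ^+ 2) = t * (E * nrm r ^+ 2).
  by rewrite /t; field; rewrite gt_eqF.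
have -> : (1 - (E / F) ^+ 2) * nrm r ^+ 2 = nrm r ^+ 2 - t * (E * nrm r ^+ 2).
  by rewrite /t; field; rewrite gt_eqF.
lra.
Qed.

(** The relaxation scheme described at the top.  That it converges is read off
    the convergence of its image, [S] being bounded below. *)
Lemma frame_operator_surj g : exists f, frame_operator f = g.
Proof.
pose x n := iter n (fun f => f + t%:C *: (g - frame_operator f)) 0.
have res n : nrm (g - frame_operator (x n)) <= q ^+ n * nrm g.
  elim: n => [|n ih]; first by rewrite /= frame_operator0 subr0 mul1r.
  have -> : g - frame_operator (x n.+1) = (g - frame_operator (x n)) -
      t%:C *: frame_operator (g - frame_operator (x n)).
    rewrite [x n.+1]addrC frame_operator_linear opprD addrA.
    by rewrite -[LHS]addrAC.
  apply: le_trans (relaxation_contraction _) _.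
  by rewrite exprS -mulrA ler_wpM2l// sqrtr_ge0.
have q1 : `|q| < 1.
  rewrite ger0_norm ?sqrtr_ge0// -(ltr_pXn2r (n := 2)) ?nnegrE ?sqrtr_ge0//.
  have EF : (E / F) ^+ 2 <= 1.
    by rewrite expr_le1// ?ler_pdivrMr ?mul1r// divr_ge0 ?ltW.
  by rewrite sqr_sqrtr ?subr_ge0// expr1n ltrBlDr ltrDl exprn_gt0// divr_gt0.
have Sx : frame_operator \o x @ \oo --> g.
  apply/cvg_nrmP => eps e0.
  have : (fun n => q ^+ n * nrm g) @ \oo --> 0 * nrm g.
    by apply: cvgM; [exact: cvg_expr|exact: cvg_cst].
  rewrite mul0r => /cvgrPdist_lt/(_ _ e0); apply: filterS => n.
  rewrite sub0r normrN; apply: le_lt_trans.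
  by apply: le_trans (res n) _; exact: ler_norm.
have /cauchy_cvgP/cvg_ex[f xf] : cauchy (x @ \oo).
  have /cvg_cauchy/cauchy_ballP cS := cvgP _ Sx.
  apply/cauchy_ballP => _ /gt0_complexE[eps e0 ->].
  have Ee : 0 < (E * eps)%:C by rewrite ltcR mulr_gt0.
  have := cS _ Ee; rewrite !near_map2; apply: filterS => -[m n] /=.
  rewrite -!ball_normE /ball_/= !nrmE !ltcR -frame_operatorB => h.
  by rewrite -(ltr_pM2l E_gt0); exact: (le_lt_trans (frame_operator_lower _) h).
exists f.
have Sxf : frame_operator \o x @ \oo --> frame_operator f.
  apply/cvg_nrmP => eps e0.
  move/(cvg_nrmP x f)/(_ _ (divr_gt0 e0 F_gt0)): xf; apply: filterS => n.
  rewrite ltr_pdivlMr// mulrC -frame_operatorB; apply: le_lt_trans.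
  exact: frame_operator_bounded.
exact: (cvg_unique (@norm_hausdorff _ V) Sxf Sx).
Qed.

(** [frame_operator] maps the partial sums of the claimed expansion of [f] to
    those of its own series at [f]; being bounded below, it reflects their
    convergence. *)
Theorem frame_reconstruction :
  [/\ linear frame_operator,
      forall f, frame_sum f @ totally --> frame_operator f
    & exists Sinv : V -> V,
      [/\ cancel frame_operator Sinv, cancel Sinv frame_operator &
        forall f, partial_sum (fun i => dot f (e i) *: Sinv (e i)) @ totally
                    --> f]].
Proof.
split; [exact: frame_operator_linear|by move=> f; exact: frame_sum_cvg|].
have [Sinv SK] := choice frame_operator_surj.
exists Sinv; split=> // [f|f]; first by apply: frame_operator_inj; rewrite SK.
have FT := @totally_filter I.
have SsumE A :
    frame_operator (partial_sum (fun i => dot f (e i) *: Sinv (e i)) A) =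
    frame_sum f A.
  rewrite /frame_sum !partial_sumE.
  elim/big_ind2 : _ => [|_ g _ h <- <-|i _]; first exact: frame_operator0.
    by have := frame_operator_linear 1 g h; rewrite !scale1r.
  have := frame_operator_linear (dot f (e i)) (Sinv (e i)) 0.
  by rewrite frame_operator0 !addr0 SK.
apply/cvg_nrmP => eps e0.
have /cvg_nrmP/(_ _ (mulr_gt0 E_gt0 e0)) := @frame_sum_cvg f.
apply: filterS => A; rewrite -SsumE -frame_operatorB => h.
by rewrite -(ltr_pM2l E_gt0); exact: (le_lt_trans (frame_operator_lower _) h).
Qed.

End Frame.
End Hilbert.

(** * The inner product of L^2(R) *)

Section L2_inner_product.
Set Implicit Arguments.
Unset Strict Implicit.
Local Open Scope complex_scope.
Local Open Scope quotient_scope.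
Variable R : realType.
Local Notation mu := (@lebesgue_measure R).
Implicit Types (f g : L2fun R) (u v w : L2 R).

Lemma sqr_Lnorm_normc (h : R -> R[i]) :
  ('N[mu]_2[EFin \o (@normc R \o h)] `^ 2 =
   \int[mu]_x (normc (h x) ^+ 2)%:E)%E.
Proof.
rewrite (poweR_Lnorm _ _ (r := 2)) ?pnatr_eq0//.
apply: eq_integral => x _ /=.
by rewrite ger0_norm ?normc_ge0// powR_mulrn ?normc_ge0.
Qed.

Lemma sqint_integralP (h : R -> R[i]) :
  reflect (cmeasurable h /\ (\int[mu]_x (normc (h x) ^+ 2)%:E < +oo)%E)
          (h \in @sqint R).
Proof.
apply: (iffP (sqintP h)) => -[mh nh]; split => //.
  by rewrite -sqr_Lnorm_normc poweR_lty.
by apply: (@lty_poweRy _ _ 2); rewrite ?pnatr_eq0// sqr_Lnorm_normc.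
Qed.

Lemma sqr_L2norm_pi f :
  ((L2norm (\pi_(L2 R) f) ^+ 2)%:E = \int[mu]_x (normc (f x) ^+ 2)%:E)%E.
Proof.
rewrite -sqr_Lnorm_normc -L2norm_pi poweR_EFin powR_mulrn//.
by rewrite -lecR -L2normE normr_ge0.
Qed.

Lemma measurable_sqr_normc (h : R -> R[i]) : cmeasurable h ->
  measurable_fun setT (fun x => (normc (h x) ^+ 2)%:E).
Proof.
by move=> mh; apply/measurable_EFinP/measurable_funX; exact: cmeasurable_normc.
Qed.

Lemma sqint_integrable_sqr (h : R -> R[i]) : h \in @sqint R ->
  mu.-integrable setT (EFin \o (fun x => normc (h x) ^+ 2)).
Proof.
move=> /sqint_integralP[mh nh]; apply/integrableP; split.
  exact: measurable_sqr_normc.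
under eq_integral do rewrite /= ger0_norm ?sqr_ge0//.
exact: nh.
Qed.

Lemma cmeasurable_conj (h : R -> R[i]) : cmeasurable h ->
  cmeasurable (fun x => (h x)^*).
Proof.
move=> [hr hi]; split.
  by apply: eq_measurable_fun hr => x _ /=; case: (h x).
rewrite (_ : _ \o _ = \- (@Im R \o h)); first exact: measurableT_comp.
by apply/funext => x /=; case: (h x).
Qed.

Lemma sqint_integrable_mulJ f g :
  mu.-integrable setT (EFin \o (fun x => Re (f x * (g x)^*))) /\
  mu.-integrable setT (EFin \o (fun x => Im (f x * (g x)^*))).
Proof.
have /sqintP[mf _] := L2funP f; have /sqintP[mg _] := L2funP g.
have [mre mim] := cmeasurableM mf (cmeasurable_conj mg).
have ifg : mu.-integrable setT
    (EFin \o (fun x => normc (f x) ^+ 2 + normc (g x) ^+ 2)).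
  exact: (integrableD measurableT (sqint_integrable_sqr (L2funP f))
            (sqint_integrable_sqr (L2funP g))).
by split; apply: le_integrable ifg => //; (try exact/measurable_EFinP);
  move=> x _ /=; rewrite lee_fin [leRHS]ger0_norm ?addr_ge0 ?sqr_ge0//;
  have [? ?] := ler_norm_ReIm_mulJ (f x) (g x).
Qed.

(** The pairing of two classes is defined on chosen representatives; this frees
    computations from the choice. *)
Lemma L2dot_pi f g :
  L2dot (\pi_(L2 R) f) (\pi_(L2 R) g) = cintegral (fun x => f x * (g x)^*).
Proof.
have eqE (h : L2fun R) :
    {ae mu, forall x, (repr (\pi_(L2 R) h) : L2fun R) x = h x}.
  by apply/L2_eqP; rewrite reprK.
have mfg (h k : L2fun R) := cmeasurableM (sqintP _ (L2funP h)).1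
  (cmeasurable_conj (sqintP _ (L2funP k)).1).
rewrite /L2dot /cintegral; congr (_ +i* _); congr fine;
  apply: ae_eq_integral => //.
1,2: by apply/measurable_EFinP; exact: (mfg _ _).1.
2,3: by apply/measurable_EFinP; exact: (mfg _ _).2.
all: move: (eqE f) (eqE g).
all: apply: (@filterS2 _ _ (ae_filter_ringOfSetsType mu)).
all: by move=> x /= -> ->.
Qed.

Lemma L2dot_linear w : linear (fun u => L2dot u w : R[i]^o).
Proof.
move=> c; elim/quotW => f; elim/quotW => g; elim/quotW: w => h.
rewrite -pi_L2_scale -pi_L2D !L2dot_pi.
transitivity (c * cintegral (fun x => f x * (h x)^*) +
              cintegral (fun x => g x * (h x)^*)); last by [].
rewrite /cintegral.
have [fr fi] := sqint_integrable_mulJ f h.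
have [gr gi] := sqint_integrable_mulJ g h.
case: c => a b.
have iZ (k : R) (F : R -> R) : mu.-integrable setT (EFin \o F) ->
    mu.-integrable setT (EFin \o (fun x => k * F x)).
  by move=> iF; exact: (integrableZl measurableT k iF).
apply/eqP; rewrite eq_complex /=; apply/andP; split.
- rewrite -!RintegralZl// -RintegralB//; [|exact: iZ..].
  rewrite -RintegralD//; last first.
    exact: (integrableB measurableT (iZ a _ fr) (iZ b _ fi)).
  apply/eqP/eq_Rintegral => x _; rewrite [(_ + _) x]/(_ * f x + g x).
  by rewrite mulrDl -mulrA ReD Defs.ReM.
- rewrite -!RintegralZl// -RintegralD//; [|exact: iZ..].
  rewrite -RintegralD//; last first.
    exact: (integrableD measurableT (iZ a _ fi) (iZ b _ fr)).
  apply/eqP/eq_Rintegral => x _; rewrite [(_ + _) x]/(_ * f x + g x).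
  by rewrite mulrDl -mulrA ImD Defs.ImM.
Qed.

Lemma L2dotC u v : L2dot v u = (L2dot u v)^*.
Proof.
elim/quotW: u => f; elim/quotW: v => g; rewrite !L2dot_pi /cintegral.
have [_ fi] := sqint_integrable_mulJ f g.
apply/eqP; rewrite eq_complex /=; apply/andP; split.
  by apply/eqP/eq_Rintegral => x _; case: (f x) (g x) => a b [c d] /=; ring.
rewrite -[eqbRHS]mulN1r -RintegralZl//; apply/eqP/eq_Rintegral => x _.
by case: (f x) (g x) => a b [c d] /=; ring.
Qed.

Lemma L2dotff u : L2dot u u = (L2norm u ^+ 2)%:C.
Proof.
elim/quotW: u => f; rewrite L2dot_pi /cintegral.
apply/eqP; rewrite eq_complex /=; apply/andP; split.
  apply/eqP/EFin_inj; rewrite sqr_L2norm_pi /Rintegral fineK; last first.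
    apply: integrable_fin_num => //; exact: (sqint_integrable_mulJ f f).1.
  apply: eq_integral => x _; rewrite sqr_normc.
  by case: (f x) => a b /=; congr EFin; ring.
rewrite (_ : (fun x => _) = cst 0) ?Rintegral0//.
  by rewrite /Rintegral integral0.
by apply/funext => x; case: (f x) => a b /=; ring.
Qed.

End L2_inner_product.

(** * Completeness of L^2(R) *)

Section L2_completeness.
Set Implicit Arguments.
Unset Strict Implicit.
Local Open Scope complex_scope.
Local Open Scope quotient_scope.
Variable R : realType.
Local Notation mu := (@lebesgue_measure R).
Implicit Types (f g : L2fun R) (u : nat -> L2fun R).

Lemma pi_L2B f g : \pi_(L2 R) (f - g) = \pi_(L2 R) f - \pi_(L2 R) g.
Proof. by rewrite !piE. Qed.

Lemma L2norm_ge0 (h : L2 R) : 0 <= L2norm h.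
Proof. by rewrite -lecR -L2normE normr_ge0. Qed.

Lemma L2norm_distC (h k : L2 R) : L2norm (h - k) = L2norm (k - h).
Proof. by apply: complexI; rewrite -!L2normE distrC. Qed.

Lemma ler_L2norm_dist (h k l : L2 R) :
  L2norm (h - l) <= L2norm (h - k) + L2norm (k - l).
Proof. by rewrite -lecR rmorphD/= -!L2normE ler_distD. Qed.

Lemma sum_geometric_le (n : nat) :
  \sum_(0 <= k < n) (4 ^- k : R) <= 2 - 2 * 4 ^- n.
Proof.
elim: n => [|n ih]; first by rewrite big_geq// expr0 invr1; lra.
rewrite big_nat_recr//= exprS invfM.
have : 0 < (4 ^- n : R) by rewrite invr_gt0 exprn_gt0.
move: ih; lra.
Qed.

Lemma cvg_geometric_increments (a : R^nat) (M : R) :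
  (forall n, `|a n.+1 - a n| <= M * 2 ^- n) -> cvgn a.
Proof.
move=> aM.
have {}aM n : `|a n.+1 - a n| <= geometric M 2^-1 n.
  by rewrite /geometric/= exprVn; exact: aM.
have : cvgn (series (telescope a)).
  apply: normed_cvg; apply: (@series_le_cvg _ _ (geometric M 2^-1)).
  - by move=> n; exact: normr_ge0.
  - by move=> n; apply: le_trans (aM n).
  - by move=> n; exact: aM.
  - by apply: is_cvg_geometric_series; rewrite ger0_norm; lra.
move=> cv; rewrite (_ : a = (fun n => a 0%N + series (telescope a) n)).
  by apply: is_cvgD => //; exact: is_cvg_cst.
by apply/funext => n; exact: eq_sum_telescope.
Qed.

(** The function [\sum_n 4^n |u_{n+1} - u_n|^2] has integral at most
    [\sum_n 4^n 16^-n], hence is finite almost everywhere; a point where it has a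
    finite value [h] satisfies [|u_{n+1} - u_n|^2 <= h 4^-n]. *)
Lemma ae_geometric_increments u :
  (forall n, L2norm (\pi_(L2 R) (u n.+1) - \pi_(L2 R) (u n)) <= 4 ^- n) ->
  {ae mu, forall x, exists M, forall n, normc (u n.+1 x - u n x) <= M * 2 ^- n}.
Proof.
move=> fast.
pose g n x := (4 ^+ n * normc (u n.+1 x - u n x) ^+ 2)%:E.
have mud n : cmeasurable (fun x => u n.+1 x - u n x).
  by have /sqintP[] := L2funP (u n.+1 - u n).
have mg n : measurable_fun setT (g n).
  apply/measurable_EFinP/measurable_funM; first exact: measurable_cst.
  by apply/measurable_EFinP; exact: measurable_sqr_normc.
have g0 n x : (0 <= g n x)%E by rewrite lee_fin mulr_ge0 ?sqr_ge0// exprn_ge0.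
have int_g n : (\int[mu]_x g n x <= (4 ^- n)%:E)%E.
  rewrite /g; under eq_integral do rewrite EFinM.
  rewrite ge0_integralZl//; last 2 first.
  - exact: measurable_sqr_normc.
  - by move=> x _; rewrite lee_fin sqr_ge0.
  rewrite -(sqr_L2norm_pi (u n.+1 - u n)) pi_L2B -EFinM lee_fin.
  rewrite -ler_pdivlMl ?exprn_gt0// -expr2.
  by rewrite lerXn2r ?nnegrE ?L2norm_ge0 ?invr_ge0 ?exprn_ge0.
have sum_g : (\int[mu]_x (\sum_(n <oo) g n x) <= 2%:E)%E.
  rewrite integral_nneseries//.
  apply: lime_le.
    by apply: is_cvg_nneseries => n _ _; exact: integral_ge0.
  apply: nearW => n; apply: (@le_trans _ _ (\sum_(0 <= k < n) (4 ^- k)%:E)%E).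
    exact: lee_sum.
  rewrite sumEFin lee_fin (le_trans (sum_geometric_le n))//.
  by rewrite gerBl mulr_ge0 ?invr_ge0 ?exprn_ge0.
have ig : mu.-integrable setT (fun x => \sum_(n <oo) g n x)%E.
  apply/integrableP; split.
    by apply: (@ge0_emeasurable_sum _ _ _ _ g xpredT) => [n x _ _|n _].
  under eq_integral do rewrite gee0_abs ?nneseries_ge0//.
  exact: le_lt_trans sum_g (ltry _).
have := integrable_ae measurableT ig.
apply: (@filterS _ _ (ae_filter_ringOfSetsType mu)) => x /(_ I) gfin.
pose h := fine (\sum_(n <oo) g n x)%E.
have h0 : 0 <= h by apply: fine_ge0; exact: nneseries_ge0.
(* [h + 1] bounds the square root of [h] *)
exists (h + 1) => n.
have gh : 4 ^+ n * normc (u n.+1 x - u n x) ^+ 2 <= h.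
  rewrite -lee_fin /h fineK//.
  have := @nneseries_lim_ge R (g ^~ x) xpredT 0 n.+1 (fun k _ _ => g0 k x).
  apply: le_trans; rewrite big_nat_recr//= leeDr//.
  by apply: sume_ge0.
rewrite -(ler_pXn2r (n := 2)) ?nnegrE ?normc_ge0//; last first.
  by rewrite mulr_ge0 ?invr_ge0 ?exprn_ge0 ?addr_ge0.
rewrite exprMn exprVn -exprM mulnC exprM (_ : 2 ^+ 2 = 4 :> R); last by ring.
rewrite ler_pdivlMr ?exprn_gt0// mulrC.
by apply: le_trans gh _; nra.
Qed.

(** An upper limit is measurable whether or not the sequence converges, so that
    the exceptional null set needs no separate treatment. *)
Definition ae_limit u (x : R) : R[i] :=
  fine (limn_esup (fun n => (Re (u n x))%:E)) +i*
  fine (limn_esup (fun n => (Im (u n x))%:E)).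

Lemma cmeasurable_ae_limit u : cmeasurable (ae_limit u).
Proof.
have mE (p : R[i] -> R) : (forall n, measurable_fun setT (p \o u n)) ->
    measurable_fun setT
      (fun x : R => fine (limn_esup (fun n => (p (u n x))%:E))).
  move=> mp; apply: (@measurableT_comp _ _ _ _ _ _ (@fine R)) => //.
  by apply: measurable_fun_limn_esup => n; apply/measurable_EFinP; exact: mp.
by split; apply: mE => n; have /sqintP[[]] := L2funP (u n).
Qed.

Lemma ae_limitP u x (M : R) :
  (forall n, normc (u n.+1 x - u n x) <= M * 2 ^- n) ->
  (fun n => Re (u n x)) @ \oo --> Re (ae_limit u x) /\
  (fun n => Im (u n x)) @ \oo --> Im (ae_limit u x).
Proof.
move=> uM.
have limE (a : R^nat) : cvgn a ->
    a @ \oo --> fine (limn_esup (fun n => (a n)%:E)).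
  move=> ca; rewrite (_ : fine _ = limn a)//.
  have /cvg_limn_einf_sup[_ ->]// : (fun n => (a n)%:E) @ \oo --> (limn a)%:E.
  by apply: cvg_EFin => //; exact: nearW.
have normc_ReIm (z : R[i]) : `|Re z| <= normc z /\ `|Im z| <= normc z.
  by rewrite Defs.normcE -!sqrtr_sqr !ler_wsqrtr ?lerDl ?lerDr ?sqr_ge0.
split; apply: limE; apply: (@cvg_geometric_increments _ M) => n.
- apply: le_trans (uM n); have [+ _] := normc_ReIm (u n.+1 x - u n x).
  by rewrite raddfB.
- apply: le_trans (uM n); have [_ +] := normc_ReIm (u n.+1 x - u n x).
  by rewrite raddfB.
Qed.

Lemma fast_L2norm_dist u :
  (forall n, L2norm (\pi_(L2 R) (u n.+1) - \pi_(L2 R) (u n)) <= 4 ^- n) ->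
  forall m n,
    L2norm (\pi_(L2 R) (u (m + n)%N) - \pi_(L2 R) (u m)) <= 2 * 4 ^- m.
Proof.
move=> fast m n.
apply: (@le_trans _ _ (4 ^- m * \sum_(0 <= k < n) (4 ^- k))).
  elim: n => [|n ih].
    by rewrite addn0 subrr big_geq// mulr0 -lecR -L2normE normr0.
  rewrite big_nat_recr//= mulrDr -invfM -exprD addnS.
  apply: le_trans (ler_L2norm_dist _ (\pi_(L2 R) (u (m + n)%N)) _) _.
  by rewrite addrC; apply: lerD.
rewrite mulrC ler_wpM2r ?invr_ge0 ?exprn_ge0//.
apply: le_trans (sum_geometric_le n) _.
by rewrite gerBl mulr_ge0 ?invr_ge0 ?exprn_ge0.
Qed.

Lemma cmeasurable_subL2 (h : R -> R[i]) g : cmeasurable h ->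
  cmeasurable (fun x => h x - g x).
Proof.
move=> mh; have mN : cmeasurable (fun x => - g x).
  by have /sqintP[] := L2funP (- g).
exact: (cmeasurableD mh mN).
Qed.

Lemma cvg_sqr_normcB (z : nat -> R[i]) (l w : R[i]) :
  (fun n => Re (z n)) @ \oo --> Re l -> (fun n => Im (z n)) @ \oo --> Im l ->
  (fun n => normc (z n - w) ^+ 2) @ \oo --> normc (l - w) ^+ 2.
Proof.
have normcB (v : R[i]) : normc (v - w) ^+ 2 =
    (Re v - Re w) ^+ 2 + (Im v - Im w) ^+ 2.
  by rewrite sqr_normc; case: v w => ? ? [? ?].
have sqrB (b : R^nat) c d : b @ \oo --> c ->
    (fun n => (b n - d) ^+ 2) @ \oo --> (c - d) ^+ 2.
  move=> bc; have bd : (fun n => b n - d) @ \oo --> c - d.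
    by apply: cvgB; [exact: bc|exact: cvg_cst].
  by rewrite expr2; exact: (cvgM bd bd).
move=> zr zi; rewrite normcB; under eq_fun do rewrite normcB.
by apply: cvgD; [exact: (sqrB _ _ _ zr)|exact: (sqrB _ _ _ zi)].
Qed.

(** Fatou's lemma along [n]: almost everywhere [|u_{m+n} - u_m|^2] tends to
    [|ae_limit u - u_m|^2], and its integral is bounded uniformly in [n]. *)
Lemma integral_ae_limit_le u :
  (forall n, L2norm (\pi_(L2 R) (u n.+1) - \pi_(L2 R) (u n)) <= 4 ^- n) ->
  forall m, (\int[mu]_x (normc (ae_limit u x - u m x) ^+ 2)%:E <=
             ((2 * 4 ^- m) ^+ 2)%:E)%E.
Proof.
move=> fast m.
pose a n x := (normc (u (m + n)%N x - u m x) ^+ 2)%:E.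
have ma n : measurable_fun setT (a n).
  apply: measurable_sqr_normc; apply: cmeasurable_subL2.
  by have /sqintP[] := L2funP (u (m + n)%N).
have -> : (\int[mu]_x (normc (ae_limit u x - u m x) ^+ 2)%:E =
           \int[mu]_x limn_einf (a ^~ x))%E.
  apply: ae_eq_integral => //.
  - apply: measurable_sqr_normc; apply: cmeasurable_subL2.
    exact: cmeasurable_ae_limit.
  - rewrite /limn_einf; apply: measurableT_comp => //.
    apply: measurable_fun_limn_esup => n.
    by apply: measurableT_comp => //; exact: ma.
  have := ae_geometric_increments fast.
  apply: (@filterS _ _ (ae_filter_ringOfSetsType mu)) => x [M uM] _.
  have [ure uim] := ae_limitP uM.
  have ax : a ^~ x @ \oo --> (normc (ae_limit u x - u m x) ^+ 2)%:E.
    apply: cvg_EFin; first exact: nearW.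
    by apply: (@cvg_sqr_normcB (fun n => u (m + n)%N x));
      [exact: (cvg_comp _ _ (cvg_addnl m) ure)
      |exact: (cvg_comp _ _ (cvg_addnl m) uim)].
  by have [-> _] := cvg_limn_einf_sup ax.
apply: le_trans (fatou mu measurableT ma _) _.
  by move=> n x _; rewrite lee_fin sqr_ge0.
rewrite limn_einf_lim; apply: lime_le; first exact: is_cvg_einfs.
apply: nearW => n; apply: (@le_trans _ _ (\int[mu]_x a n x)%E).
  by apply: ereal_inf_lbound; exists n => /=.
rewrite /a -(sqr_L2norm_pi (u (m + n)%N - u m)) pi_L2B lee_fin.
by rewrite lerXn2r ?nnegrE ?L2norm_ge0 ?fast_L2norm_dist.
Qed.

Lemma L2_fast_cvg u :
  (forall n, L2norm (\pi_(L2 R) (u n.+1) - \pi_(L2 R) (u n)) <= 4 ^- n) ->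
  exists f, forall m, L2norm (\pi_(L2 R) f - \pi_(L2 R) (u m)) <= 2 * 4 ^- m.
Proof.
move=> fast; pose l := ae_limit u.
have lS : l \in @sqint R.
  have dS : (fun x => l x - u 0%N x) \in @sqint R.
    apply/sqint_integralP; split.
      by apply: cmeasurable_subL2; exact: cmeasurable_ae_limit.
    exact: le_lt_trans (integral_ae_limit_le fast 0%N) (ltry _).
  rewrite (_ : l = (fun x => l x - u 0%N x) + (u 0%N : R -> R[i])).
    by rewrite rpredD ?L2funP.
  by apply/funext => x; apply/esym; exact: (subrK (u 0%N x) (l x)).
exists (MkL2fun lS) => m.
rewrite -(ler_pXn2r (n := 2)) ?nnegrE ?L2norm_ge0//.
by rewrite -pi_L2B -lee_fin sqr_L2norm_pi; exact: integral_ae_limit_le.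
Qed.

(** A Cauchy filter contains balls of radius [4^-n / 4] for every [n].
    Consecutive ones meet, so their centers form a sequence with increments at
    most [4^-n]; the filter converges to the limit of that sequence. *)
Lemma L2_cauchy_cvg (F : set_system (L2 R)) :
  ProperFilter F -> cauchy F -> cvg F.
Proof.
move=> FF /cauchyP Fc.
have e0 n : 0 < (4 ^- n / 4 : R) by rewrite divr_gt0 ?invr_gt0 ?exprn_gt0.
have /choice[c cP] n : exists c, F (ball c (4 ^- n / 4 : R)%:C).
  by apply: Fc; rewrite ltcR.
have ballE (h k : L2 R) (r : R) : ball h r%:C k <-> L2norm (h - k) < r.
  by rewrite -ball_normE /ball_/= L2normE ltcR.
have [|f fP] := @L2_fast_cvg (fun n => repr (c n)).
  move=> n; rewrite !reprK.
  have [k [/ballE hk /ballE kk]] := filter_ex (filterI (cP n.+1) (cP n)).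
  apply: le_trans (ler_L2norm_dist _ k _) _.
  rewrite [L2norm (k - _)]L2norm_distC.
  have := e0 n; move: hk kk; rewrite exprS invfM; lra.
apply/cvg_ex; exists (\pi_(L2 R) f); apply/cvg_ballP.
move=> _ /gt0_complexE[r r0 ->].
have [n nr] : exists n, 3 * 4 ^- n < r.
  have /cvgrPdist_lt/(_ _ (divr_gt0 r0 (ltr0n R 3))) :
      (GRing.exp (4^-1 : R)) @ \oo --> 0.
    by apply: cvg_expr; rewrite ger0_norm; lra.
  move=> [n _ /(_ n (leqnn n))]; rewrite /= sub0r normrN ger0_norm ?exprn_ge0//.
  by rewrite exprVn ltr_pdivlMr// mulrC; exists n.
near=> k; apply/ballE.
apply: le_lt_trans (ler_L2norm_dist _ (c n) _) _.
have := fP n; rewrite reprK.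
have : L2norm (c n - k) < 4 ^- n / 4 by apply/ballE; near: k; exact: cP.
by have := e0 n; move: nr; lra.
Unshelve. all: by end_near. Qed.

End L2_completeness.

HB.instance Definition _ (R : realType) :=
  Uniform_isComplete.Build (L2 R) (@L2_cauchy_cvg R).

(** * The reconstruction formula *)

Theorem theorem4p3 (R : realType) (M : unimodular R) (a0 b0 : {posnum R})
    (psi : L2fun R) (E F : R) (E_gt0 : 0 < E) (le_EF : E <= F)
    (stability : forall f : L2 R,
      ((E * L2norm f ^+ 2)%:E <=
         \esum_(j in [set: int]) \esum_(k in [set: int])
           (normc (dsawt M a0 b0 psi f j k) ^+ 2)%:E <=
       (F * L2norm f ^+ 2)%:E)%E) :
  let e := sa_wavelet M a0 b0 psi in
  let S := frame_op e in
  [/\ linear S,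
      forall f : L2 R, L2_has_sum (fun j k => L2dot f (e j k) *: e j k) (S f)
    & exists Sinv : L2 R -> L2 R,
      [/\ cancel S Sinv, cancel Sinv S
        & forall f : L2 R,
            L2_has_sum (fun j k => L2dot f (e j k) *: Sinv (e j k)) f]].
Proof.
move=> e S; pose e' (jk : int * int) : L2 R := e jk.1 jk.2.
have sqr0 f j k : 0 <= normc (dsawt M a0 b0 psi f j k) ^+ 2.
  exact: exprn_even_ge0.
have energy_le f A : energy (@L2dot R) e' f A <= F * L2norm f ^+ 2.
  by apply: (esum2_leP _ (sqr0 f)).1; have /andP[] := stability f.
have energy_ge f c : (forall A, energy (@L2dot R) e' f A <= c) ->
    E * L2norm f ^+ 2 <= c.
  move=> /(esum2_leP c (sqr0 f)).2; rewrite -lee_fin; apply: le_trans.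
  by have /andP[] := stability f.
exact: (frame_reconstruction (@L2normE R) (@L2dot_linear R) (@L2dotC R)
  (@L2dotff R) (lt_le_trans E_gt0 le_EF) energy_le E_gt0 le_EF energy_ge).
Qed.
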